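(* Let $r\ge 1$ and let $\eta_\cdot$ be a two-state one-dimensional probabilistic cellular automaton of radius $r$ belonging to the class $\mathcal{C}$, with transition probabilities $\{p(J):J\subset I_r\}$, and suppose $\mathbf{D}:=p(I_r)\in[0,1)$. Then the unique invariant measure $\mu$ of $\eta_\cdot$ is shift-mixing. Also, if $\mathbf{D}\neq 0$, then for any pair of cylinders $[U]_0=[u_0\ldots u_k]_0$, $[V]_0=[v_0\ldots v_{k'}]_0$ there is a constant $K(U,V)$, depending only on $U$, $V$, $\mathbf{D}$ and $r$, such that for all integers $t\ge |U|+|V|$ $$\left|\mu([U]_0\cap\sigma^{-t}[V]_0)-\mu([U]_0)\,\mu([V]_0)\right|\le \exp(-a\,t)\,K(U,V),$$ where $\sigma$ is the shift on $\{0,1\}^{\mathbb{Z}}$ and $a=\frac{1}{2r}\ln(1/\mathbf{D})$.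
   Context: Let $I_r=\{-r,\dots,r\}\subset\mathbb{Z}$. A two-state one-dimensional probabilistic cellular automaton (PCA) of radius $r$ with transition probabilities $\{p(J):J\subset I_r\}\subset[0,1]$ is the discrete time Markov process $\eta_\cdot$ on $\{0,1\}^{\mathbb{Z}}$ such that, given $\eta_t=x$, the coordinates $\eta_{t+1}(z)$, $z\in\mathbb{Z}$, are independent and $\eta_{t+1}(z)=1$ with probability $p(J)$, where $J=\{j\in I_r:x(z+j)=1\}$. Class $\mathcal{C}$: the PCA belongs to $\mathcal{C}$ if there is a map $\lambda$ from the set of all subsets of $I_r$ to $[0,1)$ such that $p(J)=\sum_{J'\subset J}\lambda(J')$ for all $J\subset I_r$ (the sum includes $J'=\emptyset$ and $J'=J$). For a word $U=(u_0,\dots,u_n)\in\{0,1\}^{n+1}$ and $s\in\mathbb{Z}$, $[U]_s=[u_0\ldots u_n]_s=\{x\in\{0,1\}^{\mathbb{Z}}: x(s)=u_0,\dots,x(s+n)=u_n\}$ is a cylinder, and $|U|=n+1$. The shift is $(\sigma x)(i)=x(i+1)$, so $\sigma^{-t}[V]_0=[V]_t$. A shift-invariant probability measure $\mu$ on $\{0,1\}^{\mathbb{Z}}$ is shift-mixing if $\lim_{n\to\infty}\mu(A\cap\sigma^{-n}B)=\mu(A)\mu(B)$ for all measurable $A,B$ (measurable with respect to the $\sigma$-algebra generated by cylinders). Under the stated hypotheses, the PCA has a unique invariant probability measure. *)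

(* Defs.v *)
From HB Require Import structures.
From mathcomp Require Import all_boot all_order all_algebra.
From mathcomp Require Import all_classical all_reals all_analysis.

Set Implicit Arguments.
Unset Strict Implicit.
Unset Printing Implicit Defensive.

Import Order.TTheory GRing.Theory Num.Theory.
Import numFieldNormedType.Exports.

Local Open Scope classical_set_scope.
Local Open Scope ring_scope.

(* [U]_s; the empty word is allowed here and gives the whole space. *)
Definition cylinder (s : int) (U : seq bool) : set (int -> bool) :=
  [set x | forall i : nat, (i < size U)%N -> x (s + i%:Z) = nth false U i].

Definition cylinders : set (set (int -> bool)) :=
  [set C | exists s U, C = cylinder s U].

(* {0,1}^Z with the sigma-algebra generated by the cylinders. *)
Definition configuration := g_sigma_algebraType cylinders.

HB.instance Definition _ := Measurable.on configuration.

Definition shift_map (x : configuration) : configuration := fun i : int => x (i + 1).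

(* I_r = {-r, ..., r}: the ordinal j stands for the integer j - r. *)
Notation window r := 'I_(r.*2.+1).

Definition site (r : nat) (j : window r) : int := (nat_of_ord j)%:Z - r%:Z.

Definition occupied (r : nat) (x : configuration) (z : int) : {set window r} :=
  [set j : window r | x (z + site j)]%SET.

Definition transition_probabilities (R : realType) (r : nat)
    (p : {set window r} -> R) : Prop :=
  forall J, 0 <= p J <= 1.

(* K x is the law of eta_(t+1) given eta_t = x: independence of the
   {0,1}-valued coordinates is the product formula for the joint law of every
   finite family F of them. *)
Definition is_pca (R : realType) (r : nat) (p : {set window r} -> R)
    (K : R.-pker configuration ~> configuration) : Prop :=
  forall (x : configuration) (F : seq int) (u : int -> bool), uniq F ->
    K x [set y : configuration | forall z, z \in F -> y z = u z] =
    (\prod_(z <- F)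
       (if u z then p (occupied r x z) else 1 - p (occupied r x z)))%:E.

Definition class_C (R : realType) (r : nat) (p : {set window r} -> R) : Prop :=
  exists lambda : {set window r} -> R,
    (forall J, 0 <= lambda J < 1) /\
    (forall J, p J = \sum_(J' : {set window r} | J' \subset J) lambda J').

Definition invariant_measure (R : realType)
    (K : R.-pker configuration ~> configuration)
    (mu : probability configuration R) : Prop :=
  forall A, measurable A -> (\int[mu]_x K x A)%E = mu A.

Definition shift_invariant (R : realType)
    (mu : probability configuration R) : Prop :=
  forall A, measurable A -> mu (shift_map @^-1` A) = mu A.

Definition shift_mixing (R : realType)
    (mu : probability configuration R) : Prop :=
  shift_invariant mu /\
  forall A B, measurable A -> measurable B ->
    mu (A `&` iter n shift_map @^-1` B) @[n --> \oo] --> (mu A * mu B)%E.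

(* Main.v *)
Require Import Defs.
From HB Require Import structures.
From mathcomp Require Import all_boot all_order all_algebra.
From mathcomp Require Import all_classical all_reals all_analysis measurable_realfun.
From mathcomp Require Import zify lra.

Set Implicit Arguments.
Unset Strict Implicit.
Unset Printing Implicit Defensive.

Import Order.TTheory GRing.Theory Num.Theory.
Import numFieldNormedType.Exports.

Local Open Scope classical_set_scope.
Local Open Scope ring_scope.

(** Duality. Let [phi A] be the [mu]-probability that all sites of the finite set
    [A] are occupied. In class C the kernel maps the indicator of "all of [A]
    occupied" to an average of such indicators: each [z] in [A] is independently
    replaced by [z + J] with weight [lambda J], and these weights sum to [D < 1],
    so that by invariance [phi] is a fixed point of a substochastic dual. Each step
    from a nonempty set costs a factor [D] and moves points by at most [r]; hence
    two sets at distance more than [2 r n] evolve independently for [n] steps, and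
    [|phi (A \cup B) - phi A * phi B| <= D ^ n]. The same contraction gives
    shift-invariance. Inclusion-exclusion over the zeros of the words transfers the
    bound to cylinders, and a Dynkin class argument transfers mixing to all
    measurable sets. *)

(** * The dual operator on finite sets of sites *)

Definition neighbours (r : nat) (z : int) (J : {set window r}) : seq int :=
  [seq z + site j | j in J].

(* Finite sets of sites are encoded as lists; [dual lam s f] averages [f] over the
   unions of the sets [z + J_z], [z] in [s], with weight [\prod_z lam J_z]. *)
Fixpoint dual (R : realType) (r : nat) (lam : {set window r} -> R)
    (s : seq int) (f : seq int -> R) : R :=
  if s is z :: s' then
    \sum_J lam J * dual lam s' (fun T => f (neighbours z J ++ T))
  else f [::].

Section dual_theory.
Context (R : realType) (r : nat) (lam : {set window r} -> R).
Implicit Types (s T : seq int) (f g : seq int -> R).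

Lemma eq_dual s f g : f =1 g -> dual lam s f = dual lam s g.
Proof. by move=> /funext ->. Qed.

Lemma dual_cat s1 s2 f :
  dual lam (s1 ++ s2) f =
  dual lam s1 (fun T1 => dual lam s2 (fun T2 => f (T1 ++ T2))).
Proof.
elim: s1 f => [|z s1 IH] f //=; apply: eq_bigr => J _; rewrite IH; congr (_ * _).
by apply: eq_dual => T1; apply: eq_dual => T2; rewrite catA.
Qed.

Lemma dualB s f g : dual lam s (fun T => f T - g T) = dual lam s f - dual lam s g.
Proof.
elim: s f g => [|z s IH] f g //=; rewrite -sumrB; apply: eq_bigr => J _.
by rewrite IH mulrBr.
Qed.

Lemma dualZ s c f : dual lam s (fun T => c * f T) = c * dual lam s f.
Proof.
elim: s f => [|z s IH] f //=; rewrite mulr_sumr; apply: eq_bigr => J _.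
by rewrite IH mulrCA.
Qed.

Lemma dual_shift s (c : int) f :
  dual lam (map (+%R c) s) f = dual lam s (fun T => f (map (+%R c) T)).
Proof.
elim: s f => [|z s IH] f //=; apply: eq_bigr => J _; rewrite IH; congr (_ * _).
apply: eq_dual => T; rewrite map_cat; congr (f (_ ++ _)).
rewrite /neighbours /image_mem -map_comp; apply: eq_map => j.
exact: esym (addrA _ _ _).
Qed.

Hypothesis lam_ge0 : forall J, 0 <= lam J.

(** Each site contributes one factor of the total weight. Since [z + J] stays within [r] of [z], [f]
    need only be controlled on sets that lie within distance [r] of [s]. *)
Lemma dual_bound s f e :
  (forall T, (forall z, z \in T ->
       exists2 z0, z0 \in s & z0 - r%:Z <= z <= z0 + r%:Z) ->
     `|f T| <= e) ->
  `|dual lam s f| <= (\sum_J lam J) ^+ size s * e.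
Proof.
elim: s f => [|z s IH] f Hf /=; first by rewrite expr0 mul1r; apply: Hf.
rewrite exprS -mulrA mulr_suml (le_trans (ler_norm_sum _ _ _))//.
apply: ler_sum => J _; rewrite normrM ger0_norm// ler_wpM2l//.
apply: IH => T HT; apply: Hf => y; rewrite mem_cat => /orP[|/HT[z0 z0s ?]]; last first.
  by exists z0 => //; rewrite in_cons z0s orbT.
move=> /mapP[j _ ->]; exists z; first exact: mem_head.
rewrite /site; have := ltn_ord j; lia.
Qed.

End dual_theory.

(** * Occupation events as a generating pi-system *)

Definition ones (s : seq int) : set configuration :=
  [set x | forall z, z \in s -> x z = true].

Lemma ones_nil : ones [::] = setT.
Proof. by apply/seteqP; split. Qed.

Lemma ones_cat s1 s2 : ones (s1 ++ s2) = ones s1 `&` ones s2.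
Proof.
apply/seteqP; split=> [x xs|x [x1 x2] z].
  by split=> z zs; apply: xs; rewrite mem_cat zs ?orbT.
by rewrite mem_cat => /orP[/x1|/x2].
Qed.

Lemma eq_ones s1 s2 : s1 =i s2 -> ones s1 = ones s2.
Proof. by move=> e; apply/seteqP; split=> x xs z zs; apply: xs; rewrite ?e// -e. Qed.

Lemma measurable_cylinder s U : measurable (cylinder s U : set configuration).
Proof. by apply: sub_sigma_algebra; exists s, U. Qed.

Lemma measurable_ones s : measurable (ones s).
Proof.
elim: s => [|z s IH]; first by rewrite ones_nil; exact: measurableT.
rewrite -cat1s ones_cat; apply: measurableI => //.
rewrite (_ : ones _ = cylinder z [:: true]); first exact: measurable_cylinder.
apply/seteqP; split=> [x xz [|//] _|x xz y]; first by rewrite addr0 xz ?mem_head.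
by rewrite inE => /eqP ->; have := xz 0%N isT; rewrite addr0.
Qed.

Lemma cylinder_cons s u U :
  cylinder s (u :: U) = [set x | x s = u] `&` cylinder (s + 1) U.
Proof.
apply/seteqP; split=> [x xU|x [xs xU] [|i] iU] /=.
- split=> [|i iU]; first by have := xU 0%N isT; rewrite addr0.
  by have := xU i.+1 iU; rewrite /= => <-; congr (x _); lia.
- by rewrite addr0.
- by have := xU i iU => <-; congr (x _); lia.
Qed.

Lemma ones1 z : ones [:: z] = [set x | x z = true].
Proof.
apply/seteqP; split=> x /= xz; first by apply: xz; rewrite mem_head.
by move=> y; rewrite inE => /eqP ->.
Qed.

(** A prescribed 0 is the complement of a prescribed 1, so the events [ones s] generate every
    cylinder. They are moreover stable under intersection, as Dynkin arguments require. *)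
Lemma measurable_configurationE : @measurable _ configuration = <<s range ones >>.
Proof.
apply/seteqP; split; apply: smallest_sub.
- exact: smallest_sigma_algebra.
- move=> _ [s [U ->]].
  pose M := g_sigma_algebraType (range ones).
  change (measurable (cylinder s U : set M)).
  elim: U s => [|u U IH] s.
    by rewrite (_ : cylinder s [::] = setT)//; apply/seteqP; split.
  rewrite cylinder_cons; apply: measurableI; last exact: IH.
  have m1 : measurable ([set x | x s = true] : set M).
    by apply: sub_sigma_algebra; exists [:: s] => //; rewrite ones1.
  case: u => //; rewrite (_ : [set _ | _] = ~` [set x | x s = true]).
    exact: measurableC.
  by apply/seteqP; split=> x /=; case: (x s).
- exact: (@sigma_algebra_measurable _ configuration).
- by move=> _ [s _ <-]; exact: measurable_ones.
Qed.

Lemma setI_closed_ones : setI_closed (range ones).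
Proof. by move=> _ _ [s _ <-] [t _ <-]; exists (s ++ t) => //; rewrite ones_cat. Qed.

(** Lets the class C sum over subsets of the occupied window be read as a sum over all [J], weighted
    by indicators of occupation events. *)
Lemma sub_occupied r x z (J : {set window r}) :
  (J \subset occupied r x z) = (x \in ones (neighbours z J)).
Proof.
apply/fintype.subsetP/idP => [Jx|/set_mem xJ j jJ]; last first.
  by rewrite inE; apply: xJ; apply/mapP; exists j; rewrite ?mem_enum.
by apply/mem_set => y /mapP[j]; rewrite mem_enum => /Jx; rewrite inE => ? ->.
Qed.

(** * Duality for the invariant measure and its contraction *)

Section dual_measure.
Context (R : realType) (r : nat) (lam : {set window r} -> R).
Hypothesis lam_ge0 : forall J, 0 <= lam J.

Definition all_ones_prob (mu : probability configuration R) (s : seq int) : R :=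
  fine (mu (ones s)).

Lemma dual_ge0 s f : (forall T, 0 <= f T) -> 0 <= dual lam s f.
Proof.
by elim: s f => [|z s IH] f f0 //=; apply: sumr_ge0 => J _; rewrite mulr_ge0// IH.
Qed.

Lemma measurable_dual_indic s A :
  measurable_fun setT (fun x => dual lam s (fun T => \1_(ones (A ++ T)) x)).
Proof.
elim: s A => [|z s IH] A /=; first by apply: measurable_indic; exact: measurable_ones.
apply: measurable_sum => J; apply: measurable_funM; first exact: measurable_cst.
by under eq_fun do under eq_dual do rewrite catA; exact: IH.
Qed.

(** The dual is a finite nonnegative combination, so it commutes with the integral. The prefix [A]
    collects the sets already chosen and keeps the induction going. *)
Lemma integral_dual_indic (mu : probability configuration R) s A :
  (\int[mu]_x (dual lam s (fun T => \1_(ones (A ++ T)) x))%:E =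
   (dual lam s (fun T => all_ones_prob mu (A ++ T)))%:E)%E.
Proof.
elim: s A => [|z s IH] A /=.
  rewrite integral_indic//; last exact: measurable_ones.
  by rewrite setIT /all_ones_prob fineK// fin_num_measure//; exact: measurable_ones.
have mJ J := measurable_dual_indic s (A ++ neighbours z J).
have J0 J x : 0 <= dual lam s (fun T => \1_(ones ((A ++ neighbours z J) ++ T)) x).
  by apply: dual_ge0 => T; rewrite indicE.
under eq_integral => x _ do rewrite -sumEFin.
rewrite ge0_integral_sum//; last 2 first.
- move=> J; apply/measurable_EFinP/measurable_funM; first exact: measurable_cst.
  by under eq_fun do under eq_dual do rewrite catA; exact: mJ.
- by move=> J x _; rewrite lee_fin mulr_ge0//; under eq_dual do rewrite catA.
rewrite -sumEFin; apply: eq_bigr => J _.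
under eq_integral => x _ do rewrite EFinM.
under eq_integral => x _ do under eq_dual do rewrite catA.
rewrite ge0_integralZl_EFin//; last 2 first.
- by move=> x _; rewrite lee_fin.
- exact/measurable_EFinP.
by rewrite IH -EFinM; under eq_dual do rewrite -catA.
Qed.

Context (p : {set window r} -> R).
Hypothesis pE : forall J, p J = \sum_(J' : {set window r} | J' \subset J) lam J'.

(** Expand each [p (occupied r x z)] as a sum of [lam J] over the [J] with [z + J] occupied, and
    multiply out over [s]. *)
Lemma dual_indic s A x :
  dual lam s (fun T => \1_(ones (A ++ T)) x) =
  \1_(ones A) x * \prod_(z <- s) p (occupied r x z).
Proof.
elim: s A => [|z s IH] A /=; first by rewrite cats0 big_nil mulr1.
rewrite big_cons pE [RHS]mulrCA mulr_suml [RHS]big_mkcond/=; apply: eq_bigr => J _.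
under eq_dual do rewrite catA.
rewrite IH ones_cat indicI/= sub_occupied [\1_(ones (neighbours z J)) x]indicE.
by case: (x \in ones (neighbours z J)); rewrite ?mulr1// mulr0 mul0r mulr0.
Qed.

Context (K : R.-pker configuration ~> configuration).
Context (mu : probability configuration R).
Hypotheses (pca : is_pca p K) (inv : invariant_measure K mu).
Notation phi := (all_ones_prob mu).

(** By independence the kernel gives [ones s] the product of the [p (occupied r x z)], which is a
    dual of indicators; integrate and use invariance. Distinct sites are required, since a repeated
    site would count its factor twice. *)
Lemma all_ones_prob_dual s : uniq s -> phi s = dual lam s phi.
Proof.
move=> us; rewrite -[RHS]/(fine (dual lam s phi)%:E) -(integral_dual_indic mu s [::]).
rewrite {1}/all_ones_prob -inv; last exact: measurable_ones.
congr (fine _); apply: eq_integral => x _.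
have -> := pca x (fun=> true) us.
have := dual_indic s [::] x; rewrite /= => ->.
by rewrite ones_nil indicT mul1r.
Qed.

Lemma all_ones_prob_bounds s : 0 <= phi s <= 1.
Proof.
have m := measurable_ones s; rewrite /all_ones_prob -!lee_fin.
by rewrite fineK ?fin_num_measure// measure_ge0 probability_le1.
Qed.

Lemma all_ones_prob_nil : phi [::] = 1.
Proof. by rewrite /all_ones_prob ones_nil probability_setT. Qed.

Lemma eq_all_ones_prob s1 s2 : s1 =i s2 -> phi s1 = phi s2.
Proof. by move=> e; rewrite /all_ones_prob (eq_ones e). Qed.

Notation D := (p [set: window r]%SET).
Hypothesis D01 : 0 <= D < 1.

Lemma sum_lam : \sum_J lam J = D.
Proof. by rewrite pE; apply: eq_bigl => J; rewrite finset.subsetT. Qed.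

(** The dual commutes with translations, so [phi] and its translate solve the same fixed-point
    equation; their difference shrinks by [D] at each dual step. *)
Lemma all_ones_prob_shift (c : int) s : phi (map (+%R c) s) = phi s.
Proof.
have [D0 D1] := andP D01.
suff H n : forall s, `|phi (map (+%R c) s) - phi s| <= D ^+ n.
  apply/eqP; rewrite -subr_eq0 -normr_le0.
  apply: (@cvgr_to_ge _ \oo _ _ (fun n => D ^+ n)).
    by apply: cvg_expr; rewrite ger0_norm.
  by near=> n; exact: H.
elim: n => [|n IH] {}s.
  have := all_ones_prob_bounds s; have := all_ones_prob_bounds (map (+%R c) s).
  by rewrite expr0 ler_norml; lra.
rewrite -(@eq_all_ones_prob (undup s) s); last exact: mem_undup.
rewrite -(@eq_all_ones_prob (map (+%R c) (undup s)) (map (+%R c) s)); last first.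
  by apply: eq_mem_map; exact: mem_undup.
(* The empty set yields no factor [D], but there the difference is exactly 0. *)
have [->|s0] := eqVneq (undup s) [::]; first by rewrite /= subrr normr0 exprn_ge0.
rewrite all_ones_prob_dual ?(map_inj_uniq (addrI c)) ?undup_uniq//.
rewrite dual_shift [phi (undup _)]all_ones_prob_dual ?undup_uniq// -dualB.
apply: le_trans (dual_bound lam_ge0 (fun T _ => IH T)) _.
rewrite sum_lam exprS ler_wpM2r ?exprn_ge0// -[leRHS]expr1.
by apply: ler_wiXn2l; rewrite ?(ltW D1)// lt0n size_eq0.
Unshelve. all: by end_near. Qed.

(** While the two sets are disjoint, the dual of their union is the two duals run independently. One
    step moves [x] right and [y] left by [r], spending [2 * r] of the gap and gaining a factor
    [D]. *)
Lemma all_ones_prob_decorrelation n (x y : int) s1 s2 :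
  (forall z, z \in s1 -> z <= x) -> (forall z, z \in s2 -> y <= z) ->
  x + (2 * r * n)%N%:Z < y ->
  `|phi (s1 ++ s2) - phi s1 * phi s2| <= D ^+ n.
Proof.
have [D0 D1] := andP D01.
elim: n x y s1 s2 => [|n IH] x y s1 s2 s1x s2y xy.
  have := all_ones_prob_bounds s1; have := all_ones_prob_bounds s2.
  have := all_ones_prob_bounds (s1 ++ s2).
  by rewrite expr0 ler_norml; nra.
have e1 := mem_undup s1; have e2 := mem_undup s2.
rewrite -(eq_all_ones_prob e1) -(eq_all_ones_prob e2).
rewrite -(@eq_all_ones_prob (undup s1 ++ undup s2)); last first.
  by move=> z; rewrite !mem_cat e1 e2.
have [->|n1] := eqVneq (undup s1) [::].
  by rewrite all_ones_prob_nil mul1r subrr normr0 exprn_ge0.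
(* The positive gap makes the two lists disjoint, so their concatenation has distinct sites. *)
rewrite all_ones_prob_dual; last first.
  rewrite cat_uniq !undup_uniq andbT/=; apply/hasPn => z; rewrite e2 e1 => /s2y yz.
  by apply/negP => /s1x; lia.
rewrite dual_cat (all_ones_prob_dual (undup_uniq s1)).
rewrite (all_ones_prob_dual (undup_uniq s2)).
rewrite mulrC -dualZ -dualB.
apply: (@le_trans _ _ (D ^+ size (undup s1) * D ^+ n)); last first.
  rewrite exprS ler_wpM2r ?exprn_ge0// -[leRHS]expr1.
  by apply: ler_wiXn2l; rewrite ?(ltW D1)// lt0n size_eq0.
rewrite -sum_lam; apply: dual_bound => // T1 HT1.
rewrite mulrC -dualZ -dualB.
(* The nonempty [s1] has already supplied the factor [D]; the power of [D] coming from [s2] is just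
   bounded by 1. *)
apply: (@le_trans _ _ (D ^+ size (undup s2) * D ^+ n)); last first.
  by rewrite sum_lam ler_piMl ?exprn_ge0// exprn_ile1// ltW.
rewrite -sum_lam; apply: dual_bound => // T2 HT2.
rewrite sum_lam; apply: (IH (x + r%:Z) (y - r%:Z)).
- by move=> z /HT1[z0]; rewrite e1 => /s1x; lia.
- by move=> z /HT2[z0]; rewrite e2 => /s2y; lia.
- by lia.
Qed.

End dual_measure.

(** * Extending setwise limits from a pi-system *)

(** The sets with the desired limit form a Dynkin class. Complements use the limit of the total
    masses; disjoint unions use dominated convergence for series, seen as integrals against the
    counting measure, with summable bound [mu (F k)]. *)
Lemma dominated_cvg_setwise d (T : measurableType d) (R : realType)
    (mu : probability T R) (nu : nat -> {measure set T -> \bar R}) (c : \bar R)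
    (G : set (set T)) :
  @measurable _ T = <<s G >> -> setI_closed G -> G setT -> c \is a fin_num ->
  (forall n A, measurable A -> (nu n A <= mu A)%E) ->
  (forall A, G A -> nu n A @[n --> \oo] --> (c * mu A)%E) ->
  forall A, measurable A -> nu n A @[n --> \oo] --> (c * mu A)%E.
Proof.
move=> mG GI GT cfin nu_mu nuG A; rewrite mG.
have fin A' : measurable A' -> mu A' \is a fin_num by exact: fin_num_measure.
have nufin n A' : measurable A' -> nu n A' \is a fin_num.
  move=> mA'; rewrite ge0_fin_numE ?measure_ge0//.
  by rewrite (le_lt_trans (nu_mu n A' mA'))// ltey_eq fin.
move: A; apply: (dynkin_induction mG GI (nuG _ GT) nuG).
- move=> S mS nuS; rewrite probability_setC// muleBr ?fin_num_adde_defr//.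
  rewrite -[X in (c * X - _)%E](probability_setT mu).
  under eq_fun => n do rewrite -setTD measureD ?setTI ?ltey_eq ?nufin//.
  apply: cvgeB => //; last exact: nuG.
  by rewrite fin_num_adde_defl ?fin_numN ?fin_numM// fin.
- move=> F mF tF nuF.
  have musum : (\sum_(k <oo) mu (F k) = mu (\bigcup_k F k))%E.
    by rewrite measure_semi_bigcup//; exact: bigcup_measurable.
  have muF : (counting : set nat -> \bar R).-integrable setT (fun k => mu (F k)).
    apply/integrableP; split => //.
    under eq_integral => k _ do rewrite gee0_abs ?measure_ge0//.
    by rewrite ge0_integral_count// musum ltey_eq fin//; exact: bigcup_measurable.
  have -> : (c * mu (\bigcup_k F k) = \int[counting]_k (c * mu (F k)))%E.
    by rewrite -musum -ge0_integral_count// -(fineK cfin) integralZl.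
  under eq_fun => n.
    rewrite measure_semi_bigcup//; last exact: bigcup_measurable.
    rewrite -ge0_integral_count//; over.
  apply: (@dominated_cvg _ _ _ _ _ _ _ _ (fun k => mu (F k))) => //.
  + by move=> k _; exact: fin.
  + by move=> n k _; rewrite gee0_abs ?measure_ge0// nu_mu.
Qed.

(* Bundles with [pushforward m f] the proof of measurability, which unification
   cannot recover from [f]. *)
Definition image_measure d d' (T1 : measurableType d) (T2 : measurableType d')
    (R : realType) (m : {measure set T1 -> \bar R}) (f : T1 -> T2)
    (mf : measurable_fun setT f) : {measure set T2 -> \bar R} :=
  measure_function_pushforward__canonical__measure_function_Measure m mf.

(** * Iterates of the shift *)

Lemma iter_shift_mapE n x z : iter n shift_map x z = x (n%:Z + z).
Proof. by elim: n z => [|n IH] z; rewrite ?add0r//= /shift_map IH; congr (x _); lia. Qed.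

Lemma preimage_shift_ones n s :
  iter n shift_map @^-1` ones s = ones (map (+%R n%:Z) s).
Proof.
apply/seteqP; split=> x xs z.
  by move=> /mapP[y /xs + ->]; rewrite /= iter_shift_mapE.
by move=> zs; rewrite iter_shift_mapE; apply: xs; exact: map_f.
Qed.

Lemma measurable_iter_shift n : measurable_fun setT (iter n shift_map).
Proof.
apply: (measurability (range ones)); first exact: measurable_configurationE.
move=> _ [_ [s _ <-] <-]; rewrite setTI preimage_shift_ones.
exact: measurable_ones.
Qed.

Lemma preimage_cylinder t s V :
  iter t shift_map @^-1` cylinder s V = cylinder (t%:Z + s) V.
Proof.
apply/seteqP; split=> x xV i iV; first by rewrite -(xV i iV) iter_shift_mapE addrA.
by rewrite iter_shift_mapE addrA xV.
Qed.

Lemma seq_int_bounded (s : seq int) : exists c : nat, forall z, z \in s -> `|z| <= c%:Z.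
Proof.
elim: s => [|y s [c IH]]; first by exists 0%N.
exists (c + `|y|)%N => z; rewrite inE => /orP[/eqP ->|/IH]; lia.
Qed.

(** * Cylinders as patterns of ones and zeros *)

(** Arbitrary finite sets of sites are allowed, so that inclusion-exclusion can move a single site
    from [Z] to [A]. *)
Definition pattern (A Z : seq int) : set configuration :=
  ones A `&` [set x | forall z, z \in Z -> x z = false].

Lemma pattern_cons A z Z : pattern A (z :: Z) = pattern A Z `\` pattern (z :: A) Z.
Proof.
apply/seteqP; split=> x.
  move=> [xA xZ]; split.
    by split=> // y yZ; apply: xZ; rewrite inE yZ orbT.
  by move=> [xzA _]; have := xzA z (mem_head _ _); rewrite xZ ?mem_head.
move=> [[xA xZ] nx]; split=> // y; rewrite inE => /orP[/eqP ->|/xZ//].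
apply/negbTE/negP => xz; apply: nx; split=> // w.
by rewrite inE => /orP[/eqP ->|/xA].
Qed.

Lemma pattern_cat A B Z W : pattern (A ++ B) (Z ++ W) = pattern A Z `&` pattern B W.
Proof.
rewrite /pattern ones_cat setIACA; congr (_ `&` _).
apply/seteqP; split=> [x xs|x [x1 x2] z].
  by split=> z zs; apply: xs; rewrite mem_cat zs ?orbT.
by rewrite mem_cat => /orP[/x1|/x2].
Qed.

Lemma measurable_pattern A Z : measurable (pattern A Z).
Proof.
elim: Z A => [|z Z IH] A; last by rewrite pattern_cons; exact: measurableD.
rewrite (_ : pattern A [::] = ones A); first exact: measurable_ones.
by apply/seteqP; split=> [x []|].
Qed.

Definition positions (b : bool) (s : int) (U : seq bool) : seq int :=
  [seq s + i%:Z | i <- iota 0 (size U) & nth false U i == b].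

Lemma size_positions b s U : (size (positions b s U) <= size U)%N.
Proof. by rewrite size_map (leq_trans (size_subseq (filter_subseq _ _)))// size_iota. Qed.

Lemma positions_bounds b s U z :
  z \in positions b s U -> s <= z < s + (size U)%:Z.
Proof. by move=> /mapP[i]; rewrite mem_filter mem_iota => /andP[_ ?] ->; lia. Qed.

Lemma cylinder_pattern s U :
  cylinder s U = pattern (positions true s U) (positions false s U).
Proof.
have posP b x : (forall z, z \in positions b s U -> x z = b) <->
    (forall i, (i < size U)%N -> nth false U i = b -> x (s + i%:Z) = b).
  split=> [H i iU Ub|H _ /mapP[i + ->]].
    by apply: H; apply: map_f; rewrite mem_filter Ub eqxx mem_iota.
  by rewrite mem_filter mem_iota add0n => /andP[/eqP ? /= ?]; exact: H.
apply/seteqP; split=> x.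
  by move=> xU; split; apply/posP => i iU Ub; rewrite xU.
move=> [/posP xT /posP xF] i iU.
by case e: (nth false U i); [exact: xT|exact: xF].
Qed.

(** * Shift-mixing and decay of correlations *)

Section invariant_measure.
Context (R : realType) (r : nat) (lam p : {set window r} -> R).
Context (K : R.-pker configuration ~> configuration).
Context (mu : probability configuration R).
Hypothesis lam_ge0 : forall J, 0 <= lam J.
Hypothesis pE : forall J, p J = \sum_(J' : {set window r} | J' \subset J) lam J'.
Hypotheses (pca : is_pca p K) (inv : invariant_measure K mu).
Notation D := (p [set: window r]%SET).
Hypothesis D01 : 0 <= D < 1.

Lemma mu_onesE s : mu (ones s) = (all_ones_prob mu s)%:E.
Proof. by rewrite /all_ones_prob fineK// fin_num_measure//; exact: measurable_ones. Qed.

Lemma invariant_measure_shift n A :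
  measurable A -> mu (iter n shift_map @^-1` A) = mu A.
Proof.
rewrite -[LHS]/(image_measure mu (measurable_iter_shift n) A); move: A.
apply: (measure_unique (range ones) (fun=> setT)) => //.
- exact: measurable_configurationE.
- exact: setI_closed_ones.
- by move=> _; exists [::] => //; rewrite ones_nil.
- by rewrite bigcup_const.
- move=> _ [s _ <-]; rewrite -[LHS]/(mu (iter n shift_map @^-1` ones s)).
  rewrite preimage_shift_ones; apply: etrans (esym (mu_onesE s)).
  by rewrite mu_onesE (all_ones_prob_shift lam_ge0 pE pca inv D01).
- by move=> _; rewrite -[X in (X < _)%E]/(mu setT) probability_setT ltry.
Qed.

Lemma ones_mixing s1 s2 :
  mu (ones s1 `&` iter n shift_map @^-1` ones s2) @[n --> \oo] -->
  (mu (ones s1) * mu (ones s2))%E.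
Proof.
have [D0 D1] := andP D01.
under eq_fun do rewrite preimage_shift_ones -ones_cat mu_onesE.
rewrite !mu_onesE -EFinM; apply: cvg_EFin; first by near=> n.
apply/cvgrPdist_le => e e0.
have [m De] : exists m : nat, D ^+ m <= e.
  have absD1 : `|D| < 1 by rewrite ger0_norm.
  have /cvgrPdist_le/(_ e e0)[m _ /(_ m (leqnn m))] := cvg_expr absD1.
  by rewrite sub0r normrN /= ger0_norm ?exprn_ge0// => ?; exists m.
have [c1 c1P] := seq_int_bounded s1; have [c2 c2P] := seq_int_bounded s2.
(* [s1] lies left of [c1] and the translate of [s2] right of [n - c2]; beyond this threshold the gap
   exceeds [2 * r * m]. *)
exists (c1 + c2 + 2 * r * m).+1 => // n /= nN.
rewrite distrC -(all_ones_prob_shift lam_ge0 pE pca inv D01 n s2).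
apply: le_trans De.
apply: (all_ones_prob_decorrelation lam_ge0 pE pca inv D01
  (x := c1%:Z) (y := n%:Z - c2%:Z)).
- by move=> z /c1P; lia.
- by move=> _ /mapP[z /c2P + ->]; lia.
- by lia.
Unshelve. all: by end_near. Qed.

Lemma invariant_measure_mixing : shift_mixing mu.
Proof.
split=> [A mA|A B mA mB]; first exact: (invariant_measure_shift 1).
have mpre n X : measurable X -> measurable (iter n shift_map @^-1` X).
  by move=> mX; rewrite -[X in measurable X]setTI; exact: measurable_iter_shift.
(* The first set is freed from being an occupation event while the second stays one; the
   restrictions of [mu] are dominated by [mu]. *)
have mixA s : mu (A `&` iter n shift_map @^-1` ones s) @[n --> \oo] -->
              (mu A * mu (ones s))%E.
  rewrite muleC.
  apply: (dominated_cvg_setwise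
    (nu := fun n => mrestr mu (mpre n _ (measurable_ones s)))
    measurable_configurationE setI_closed_ones) => //.
  - by exists [::] => //; rewrite ones_nil.
  - by rewrite fin_num_measure//; exact: measurable_ones.
  - move=> n X mX; apply: le_measure; [rewrite inE|by rewrite inE|exact: subIsetl].
    by apply: measurableI => //; apply: mpre; exact: measurable_ones.
  - by move=> _ [s' _ <-]; rewrite muleC; exact: ones_mixing.
have E n X : mu (A `&` iter n shift_map @^-1` X) =
             image_measure (mrestr mu mA) (measurable_iter_shift n) X.
  by rewrite /= /pushforward /mrestr setIC.
under eq_fun do rewrite E.
(* Now the second set is freed with [A] fixed; domination by [mu] comes from shift-invariance. *)
apply: (dominated_cvg_setwise
  (nu := fun n => image_measure (mrestr mu mA) (measurable_iter_shift n))
  measurable_configurationE setI_closed_ones) => //.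
- by exists [::] => //; rewrite ones_nil.
- by rewrite fin_num_measure.
- move=> n X mX; rewrite -(invariant_measure_shift n mX).
  apply: le_measure; [rewrite inE|rewrite inE; exact: mpre|exact: subIsetl].
  by apply: measurableI => //; exact: mpre.
- by move=> _ [s _ <-]; under eq_fun do rewrite -E; exact: mixA.
Qed.

Lemma fine_pattern_cons A z Z :
  fine (mu (pattern A (z :: Z))) =
  fine (mu (pattern A Z)) - fine (mu (pattern (z :: A) Z)).
Proof.
have m := measurable_pattern; have f A' Z' := fin_num_measure mu _ (m A' Z').
rewrite pattern_cons measureD ?ltey_eq ?f//.
rewrite setIidr ?fineB ?f// => x [xzA xZ]; split=> // y yA; apply: xzA.
by rewrite inE yA orbT.
Qed.

(** Trading a zero for a one writes the covariance as a difference of two covariances with one zero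
    fewer, so each zero doubles the error. *)
Lemma pattern_decorrelation n (x y : int) A B Z W :
  (forall z, z \in A ++ Z -> z <= x) -> (forall z, z \in B ++ W -> y <= z) ->
  x + (2 * r * n)%N%:Z < y ->
  `|fine (mu (pattern (A ++ B) (Z ++ W)))
    - fine (mu (pattern A Z)) * fine (mu (pattern B W))|
  <= 2 ^+ (size Z + size W) * D ^+ n.
Proof.
move=> + + xy; elim: Z A => [|z Z IH] A Ax By /=.
  elim: W B By => [|w W IH] B By /=.
    have p0 C : pattern C [::] = ones C by apply/seteqP; split=> [? []|].
    rewrite !p0 mul1r.
    apply: (all_ones_prob_decorrelation lam_ge0 pE pca inv D01 _ _ xy) => z zs.
      by apply: Ax; rewrite cats0.
    by apply: By; rewrite cats0.
  have /IH h1 : forall z, z \in B ++ W -> y <= z.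
    by move=> z zB; apply: By; rewrite mem_cat inE orbCA -mem_cat zB orbT.
  have /IH h2 : forall z, z \in (w :: B) ++ W -> y <= z.
    by move=> z zB; apply: By; move: zB; rewrite /= !(inE, mem_cat) orbCA.
  have e : pattern (A ++ w :: B) W = pattern (w :: A ++ B) W.
    by rewrite /pattern (@eq_ones _ (w :: A ++ B))// => z; rewrite !(inE, mem_cat) orbCA.
  rewrite !fine_pattern_cons; move: h1 h2; rewrite /= e exprS !ler_norml.
  rewrite add0n; nra.
have /IH/(_ By) h1 : forall z, z \in A ++ Z -> z <= x.
  by move=> z' zA; apply: Ax; rewrite mem_cat inE orbCA -mem_cat zA orbT.
have /IH/(_ By) h2 : forall z', z' \in (z :: A) ++ Z -> z' <= x.
  by move=> z' zA; apply: Ax; move: zA; rewrite /= !(inE, mem_cat) orbCA.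
rewrite !fine_pattern_cons; move: h1 h2; rewrite /= exprS !ler_norml; nra.
Qed.

Lemma cylinder_decorrelation n U V t :
  (size U + 2 * r * n <= t)%N ->
  `|fine (mu (cylinder 0 U `&` iter t shift_map @^-1` cylinder 0 V))
    - fine (mu (cylinder 0 U)) * fine (mu (cylinder 0 V))|
  <= 2 ^+ (size U + size V) * D ^+ n.
Proof.
move=> tn; have [D0 _] := andP D01.
rewrite -(invariant_measure_shift t (measurable_cylinder 0 V)) preimage_cylinder.
rewrite !cylinder_pattern -pattern_cat.
pose k := (size (positions false 0 U) + size (positions false (t%:Z + 0) V))%N.
apply: (@le_trans _ _ (2 ^+ k * D ^+ n)).
  (* The last site of [U] is [size U - 1], so the weak bound on [t] gives the strict gap. *)
  apply: (pattern_decorrelation (x := (size U)%:Z - 1) (y := t)).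
  - by move=> z; rewrite mem_cat => /orP[] /positions_bounds; lia.
  - by move=> z; rewrite mem_cat => /orP[] /positions_bounds; lia.
  - by lia.
apply: ler_wpM2r; first exact: exprn_ge0.
by apply: ler_weXn2l; rewrite ?ler1n// leq_add ?size_positions.
Qed.

End invariant_measure.

Theorem theorem3 (R : realType) :
  exists K_UV : nat -> R -> seq bool -> seq bool -> R,
  forall (r : nat) (p : {set window r} -> R)
    (K : R.-pker configuration ~> configuration)
    (mu : probability configuration R),
  (1 <= r)%N ->
  transition_probabilities p ->
  class_C p ->
  is_pca p K ->
  0 <= p [set: window r]%SET < 1 ->
  invariant_measure K mu ->
  shift_mixing mu /\
  (p [set: window r]%SET != 0 ->
   forall U V : seq bool, (0 < size U)%N -> (0 < size V)%N ->
   forall t : nat, (size U + size V <= t)%N ->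
   let D := p [set: window r]%SET in
   let a := (2 * r%:R)^-1 * ln (1 / D) in
   (`| mu (cylinder 0 U `&` iter t shift_map @^-1` cylinder 0 V)
       - mu (cylinder 0 U) * mu (cylinder 0 V) |
    <= (expR (- a * t%:R) * K_UV r D U V)%:E)%E).
Proof.
(* With [n] the integer part of [(t - |U|) / (2 r)], [n >= t / (2 r) - (|U| / (2 r) + 1)]. The first
   term gives [exp (- a t)], the bracket the exponential here, and the power of 2 is the cost of the
   zeros. *)
exists (fun r D U V =>
  2 ^+ (size U + size V) * expR (- ((size U)%:R / (2 * r%:R) + 1) * ln D)).
move=> r p K mu r1 _ [lam [lam01 pE]] pca D01 inv.
have lam_ge0 J : 0 <= lam J by case/andP: (lam01 J).
split; first exact: invariant_measure_mixing lam_ge0 pE pca inv D01.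
move=> Dn0 U V _ _ t Ut; cbv zeta; set D := p _ in Dn0 D01 *.
have [D0 D1] := andP D01.
have Dgt0 : 0 < D by rewrite lt_neqAle eq_sym Dn0.
have mV : measurable (cylinder 0 V : set configuration) by exact: measurable_cylinder.
have mU : measurable (cylinder 0 U : set configuration) by exact: measurable_cylinder.
rewrite -(fineK (fin_num_measure mu _ mU)) -(fineK (fin_num_measure mu _ mV)).
rewrite -[mu (_ `&` _)]fineK; last first.
  rewrite fin_num_measure//; apply: measurableI => //.
  by rewrite preimage_cylinder; exact: measurable_cylinder.
rewrite -EFinM -EFinB abse_EFin lee_fin.
(* The largest number of dual steps that fits between the two words. *)
pose n := ((t - size U) %/ (2 * r))%N.
have tn : (size U + 2 * r * n <= t)%N.
  by have := leq_divM (t - size U) (2 * r); rewrite -/n; lia.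
have tn1 : (t < size U + 2 * r * n.+1)%N.
  by have := ltn_ceil (t - size U) (_ : 0 < 2 * r)%N; rewrite -/n; lia.
apply: le_trans (cylinder_decorrelation lam_ge0 pE pca inv D01 V tn) _.
rewrite mulrCA ler_wpM2l ?exprn_ge0//.
rewrite -[D ^+ n]lnK ?posrE ?exprn_gt0// -expRD ler_expR lnXn// div1r lnV ?posrE//.
have L0 : ln D < 0 by rewrite ln_lt0 ?Dgt0.
have r0 : 0 < 2 * r%:R :> R by rewrite mulr_gt0 ?ltr0n.
(* Multiplying by the negative [ln D] reverses this and gives the required comparison of
   exponents. *)
have h : t%:R / (2 * r%:R) <= (size U)%:R / (2 * r%:R) + n%:R + 1 :> R.
  rewrite ler_pdivrMr// -addrA mulrDl divfK ?gt_eqF//.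
  by rewrite natr1 -!natrM -natrD ler_nat; lia.
rewrite -[ln D *+ n]mulr_natr; have := ler_wnM2l (ltW L0) h; lra.
Qed.
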